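(* For all $n,k\in\mathbb{N}$ with $n\ge k+2$, $$\tau_{n,k}^2\le \frac12\Big(1+\frac{k}{n}\Big)\Big(\frac{n}{k}\Big)^{2k}\binom{n+k}{n-k}^{-1}\le c_1^2\,k^{1/2}\Big(1-\frac{k^2}{n^2}\Big)^{1/2}\frac{(2n)^{2k}(n-k)^{n-k}}{(n+k)^{n+k}},\qquad c_1^2=\frac{e^2}{2\sqrt\pi}.$$
   Context: $T_n$ denotes the Chebyshev polynomial of the first kind of degree $n$, $T_n(\cos\theta)=\cos n\theta$. For integers $n\ge k+2$, $k\ge 1$, let $\omega_{n,k}$ be the rightmost (largest) zero of $T_n^{(k+1)}$ and define $\tau_{n,k}:=|T_n^{(k)}(\omega_{n,k})|/T_n^{(k)}(1)$. *)

(* Defs.v *)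
From HB Require Import structures.
From mathcomp Require Import all_boot all_order all_algebra.
From mathcomp Require Import all_classical all_reals all_analysis.
Set Implicit Arguments. Unset Strict Implicit. Unset Printing Implicit Defensive.
Import Order.TTheory GRing.Theory Num.Theory.
Local Open Scope ring_scope.

Fixpoint cheb_pair (R : nzRingType) (m : nat) : {poly R} * {poly R} :=
  match m with
  | 0%N => (1, 'X)
  | m'.+1 => let p := cheb_pair R m' in (p.2, 2%:R *: 'X * p.2 - p.1)
  end.

Definition cheb (R : nzRingType) (m : nat) : {poly R} := (cheb_pair R m).1.

(* tau_{n,k} given the rightmost zero w of T_n^{(k+1)} *)
Definition tau (R : realType) (n k : nat) (w : R) : R :=
  `|((cheb R n)^`(k)).[w]| / ((cheb R n)^`(k)).[1].

(* Main.v *)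
Require Import Defs.
From HB Require Import structures.
From mathcomp Require Import all_boot all_order all_algebra.
From mathcomp Require Import all_classical all_reals all_analysis.
From mathcomp Require Import polyrcf ring lra zify.
Import Order.TTheory GRing.Theory Num.Theory.
Local Open Scope ring_scope.

(* Write $y = T_n^{(k)}$ and $\lambda_j = n^2 - j^2$. Put
   $D(x) = y^2 + (\sin(n \arccos x))^{(k)\,2} \ge y^2$. A first order recurrence
   in $k$ shows that $D$ is a polynomial in $1/(1-x^2)$ with explicit nonnegative
   coefficients. A convexity argument for $\sin^{k+1}\theta\,y'(\cos\theta)$
   gives $1-\omega^2 \ge k(k+1)/n^2 \ge k^2/n^2$ at the rightmost zero $\omega$
   of $y'$, so that $y(\omega)^2 \le D|_{1-x^2 = k^2/n^2}$. Comparing each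
   $\lambda_j$ with $(n/k)^2(k^2-j^2)$ reduces the latter to a closed-form sum
   of Wallis ratios, which is the first bound.

   The second bound amounts to $s_{2k}s_{n-k}/s_{n+k} \le e^4/(2\pi)$ for
   $s_N = (N!\,e^N/N^N)^2/N$. The sequence $s$ is nonincreasing, with
   $s_2 = e^4/8$, and the crude lower bound $s_N \ge e^{9/5}$ suffices because
   $\pi \le 10/3$; the sharp Stirling constant is not needed. *)

(** * Chebyshev derivatives and their Duffin-Schaeffer majorant *)

Section Cheb.
Variable R : numDomainType.
Local Notation Y := (1 - 'X^2 : {poly R}).
Implicit Types n k m : nat.

Lemma chebSS n : cheb R n.+2 = 2%:R * 'X * cheb R n.+1 - cheb R n.
Proof. by rewrite /cheb /= -mul_polyC polyC_natr. Qed.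

Lemma horner_natr m (x : R) : (m%:R : {poly R}).[x] = m%:R.
Proof. by rewrite -polyC_natr hornerC. Qed.

Lemma deriv_Y : Y^`() = - (2%:R * 'X).
Proof. by rewrite derivB derivXn derivC /= expr1 sub0r mulr_natl. Qed.

Lemma deriv_natl m (p : {poly R}) : (m%:R * p)^`() = m%:R * p^`().
Proof. by rewrite !mulr_natl derivMn. Qed.

(** Proved jointly: the three-term recurrence turns the pair at $n$ into the pair at $n+1$. *)
Lemma deriv_cheb_pair n :
  Y * (cheb R n)^`() = n%:R * ('X * cheb R n - cheb R n.+1) /\
  Y * (cheb R n.+1)^`() = n.+1%:R * (cheb R n - 'X * cheb R n.+1).
Proof.
elim: n => [|n [IH1 IH2]].
  rewrite /cheb /= derivC derivX; split; ring.
split; rewrite chebSS; first by rewrite IH2; ring.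
rewrite derivB -mulrA deriv_natl derivM derivX mul1r mulrBr IH1.
rewrite [Y * _](_ : _ = 2%:R * (Y * cheb R n.+1 + 'X * (Y * (cheb R n.+1)^`())));
  last by ring.
rewrite IH2; ring.
Qed.

Lemma Y_neq0 : Y != 0.
Proof.
by apply/eqP => /(congr1 (fun p : {poly R} => p.[0])); rewrite !hornerE expr0n /= subr0
  => /eqP; rewrite oner_eq0.
Qed.

(** Differentiating the first relation of [deriv_cheb_pair] brings in $T_{n+1}'$; a further factor
    $1-x^2$, cancellable in the end, lets the second relation eliminate it. *)
Lemma cheb_ode0 n :
  Y * (cheb R n)^`()^`() = 'X * (cheb R n)^`() - n%:R ^+ 2 * cheb R n.
Proof.
have [E1 E2] := deriv_cheb_pair n.
have E3 := congr1 (@deriv R) E1; move: E3.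
rewrite derivM deriv_Y deriv_natl derivB derivM derivX => E3.
apply: (mulfI Y_neq0).
have E4 : Y * (Y * (cheb R n)^`()^`()) = 2%:R * 'X * (Y * (cheb R n)^`())
  + n%:R * (Y * cheb R n + 'X * (Y * (cheb R n)^`()) - Y * (cheb R n.+1)^`()).
  transitivity (2%:R * 'X * (Y * (cheb R n)^`()) + Y * (- (2%:R * 'X) * (cheb R n)^`()
    + Y * (cheb R n)^`()^`())); first by ring.
  by rewrite E3; ring.
rewrite E4 E2 (mulrBr Y) (mulrCA Y 'X) E1; ring.
Qed.

(** The Chebyshev equation [cheb_ode0] differentiated $k$ times. *)
Lemma cheb_ode n k :
  Y * (cheb R n)^`(k.+2) =
  (2 * k + 1)%:R * 'X * (cheb R n)^`(k.+1)
  - (n%:R ^+ 2 - k%:R ^+ 2) * (cheb R n)^`(k).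
Proof.
elim: k => [|k IH].
  rewrite /= cheb_ode0; ring.
have := congr1 (@deriv R) IH.
rewrite derivM deriv_Y derivB -mulrA deriv_natl derivM derivX.
have -> : n%:R ^+ 2 - k%:R ^+ 2 = (n%:R ^+ 2 - k%:R ^+ 2)%:P :> {poly R}.
  by rewrite rmorphB !rmorphXn !rmorph_nat.
rewrite derivM derivC mul0r add0r rmorphB !rmorphXn !rmorph_nat -!derivnS => E.
transitivity (- (2%:R * 'X) * (cheb R n)^`(k.+2) + Y * (cheb R n)^`(k.+3) + 2%:R * 'X
  * (cheb R n)^`(k.+2)); first by ring.
rewrite E; ring.
Qed.

Lemma cheb1 n : (cheb R n).[1] = 1.
Proof.
suff : (cheb R n).[1] = 1 /\ (cheb R n.+1).[1] = 1 by case.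
elim: n => [|n [IH1 IH2]]; first by rewrite /cheb /= hornerC hornerX.
by split=> //; rewrite chebSS !hornerE IH1 IH2; ring.
Qed.

(** At $x = 1$ the leading term of [cheb_ode] drops out. *)
Lemma cheb_derivn1S n k :
  (2 * k + 1)%:R * ((cheb R n)^`(k.+1)).[1] =
  (n%:R ^+ 2 - k%:R ^+ 2) * ((cheb R n)^`(k)).[1].
Proof.
have := congr1 (fun p => p.[1]) (cheb_ode n k).
rewrite !hornerE !horner_natr expr1n subrr mul0r => /esym/eqP.
by rewrite subr_eq0 => /eqP.
Qed.

Lemma cheb_parity n : cheb R n \Po (- 'X) = (-1) ^+ n * cheb R n.
Proof.
suff : cheb R n \Po (- 'X) = (-1) ^+ n * cheb R n /\ cheb R n.+1 \Po (- 'X)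
  = (-1) ^+ n.+1 * cheb R n.+1 by case.
elim: n => [|n [IH1 IH2]]; first by rewrite /cheb /= comp_polyC comp_polyX; split; ring.
split=> //; rewrite chebSS rmorphB !rmorphM /= IH1 IH2 rmorph_nat comp_polyX !exprS;
  ring.
Qed.

Lemma cheb_derivn_parity n k :
  (cheb R n)^`(k) \Po (- 'X) = (-1) ^+ (n + k) * (cheb R n)^`(k).
Proof.
elim: k => [|k IH]; first by rewrite addn0 cheb_parity.
have := congr1 (@deriv R) IH.
have -> : (-1) ^+ (n + k) = ((-1) ^+ (n + k))%:P :> {poly R} by rewrite rmorphXn rmorphN
  rmorph1.
rewrite deriv_comp derivN derivX derivM derivC mul0r add0r -derivnS rmorphXn rmorphN
  rmorph1 => E.
by rewrite addnS exprS -mulrA -E; ring.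
Qed.

Lemma deriv_inj_at (p q : {poly R}) x : p^`() = q^`() -> p.[x] = q.[x] -> p = q.
Proof.
move=> /eqP; rewrite -subr_eq0 -derivB => /eqP dpq pq.
have E : p - q = ((p - q)`_0)%:P.
  apply/polyP => -[|i]; rewrite coefC //=.
  have := congr1 (fun r : {poly R} => r`_i) dpq.
  by rewrite coef_deriv coef0 => /eqP; rewrite mulrn_eq0 => /eqP.
apply/eqP; rewrite -subr_eq0 E.
have := congr1 (fun r : {poly R} => r.[x]) E.
by rewrite hornerC hornerD hornerN pq subrr => <-; rewrite polyC0.
Qed.

Lemma deriv_sub_sqr m k (p : {poly R}) :
  ((m%:R ^+ 2 - k%:R ^+ 2) * p)^`() = (m%:R ^+ 2 - k%:R ^+ 2) * p^`().
Proof.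
have -> : m%:R ^+ 2 - k%:R ^+ 2 = (m%:R ^+ 2 - k%:R ^+ 2)%:P :> {poly R}.
  by rewrite rmorphB !rmorphXn !rmorph_nat.
by rewrite mul_polyC derivZ mul_polyC.
Qed.

(* [cheb_conj n j] is $(1-x^2)^{j+1/2}$ times minus the derivative of order
   [j.+1] of the second solution $\sin(n \arccos x)$. *)
Fixpoint cheb_conj n j : {poly R} :=
  if j is j'.+1 then Y * (cheb_conj n j')^`() + (2 * j' + 1)%:R * 'X * cheb_conj n j'
  else n%:R * cheb R n.

(** This is the equation of [cheb_ode], at order [j.+1], for the second solution, once the
    half-integer powers of $1-x^2$ are cleared. *)
Lemma deriv_cheb_conj n j :
  (cheb_conj n j.+1)^`() = - (n%:R ^+ 2 - j.+1%:R ^+ 2) * cheb_conj n j.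
Proof.
elim: j => [|j IH].
  rewrite /= muln0 add0n mul1r derivD derivM deriv_Y !deriv_natl derivM derivX
    deriv_natl.
  transitivity (n%:R * (Y * (cheb R n)^`()^`() - 'X * (cheb R n)^`() + cheb R n));
    first by ring.
  rewrite cheb_ode0; ring.
have E : cheb_conj n j.+2 = Y * (cheb_conj n j.+1)^`() + (2 * j.+1 + 1)%:R * 'X
  * cheb_conj n j.+1 by [].
have E1 : cheb_conj n j.+1 = Y * (cheb_conj n j)^`() + (2 * j + 1)%:R * 'X * cheb_conj n
  j by [].
rewrite E derivD derivM -mulrA deriv_natl derivM derivX deriv_Y IH.
rewrite mulNr derivN deriv_sub_sqr.
transitivity (- (n%:R ^+ 2 - j.+1%:R ^+ 2) * (Y * (cheb_conj n j)^`() + (2 * j + 1)%:R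
  * 'X * cheb_conj n j) + (2 * j.+1 + 1)%:R * cheb_conj n j.+1); first by ring.
rewrite -E1; ring.
Qed.

Lemma cheb_conj1 n j : (cheb_conj n j).[1] = n%:R * \prod_(i < j) (2 * i + 1)%:R.
Proof.
elim: j => [|j IH]; first by rewrite big_ord0 /= hornerM horner_natr cheb1.
rewrite /= !hornerE !horner_natr expr1n IH big_ord_recr /=; ring.
Qed.

(* [(1 - x^2)^(2j+1) * D(x)] for the derivatives of order [k = j.+1]. *)
Definition amp_poly n j : {poly R} :=
  Y ^+ (2 * j + 1) * (cheb R n)^`(j.+1) ^+ 2 + cheb_conj n j ^+ 2.

Lemma amp_poly1 n j : (amp_poly n j).[1] = (n%:R * \prod_(i < j) (2 * i + 1)%:R) ^+ 2.
Proof.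
have Y1 : Y.[1] = 0 by rewrite !hornerE expr1n subrr.
by rewrite /amp_poly hornerD hornerM !horner_exp cheb_conj1 Y1 addn1 exprS !mul0r add0r.
Qed.

(** The first-order recurrence for $D$. On the left [cheb_ode] cancels the squares of $T_n^{(j+2)}$,
    on the right those of $T_n^{(j+1)}$ cancel; the same cross term $T_n^{(j+1)}T_n^{(j+2)}$
    survives on both sides, and [deriv_cheb_conj] matches the conjugate parts. *)
Lemma deriv_amp_poly n j : (amp_poly n j.+1)^`() =
  - (n%:R ^+ 2 - j.+1%:R ^+ 2) *
    (Y * (amp_poly n j)^`() + (2 * (2 * j + 1))%:R * 'X * amp_poly n j).
Proof.
set y1 := (cheb R n)^`(j.+1); set y2 := (cheb R n)^`(j.+2).
have E1 : cheb_conj n j.+1 = Y * (cheb_conj n j)^`() + (2 * j + 1)%:R * 'X * cheb_conj n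
  j by [].
have dq := deriv_cheb_conj n j.
have ode := cheb_ode n j.+1; rewrite -/y1 -/y2 in ode.
have d1 : y1^`() = y2 by [].
have -> : (amp_poly n j)^`() = - ((2 * j + 1)%:R * (2%:R * 'X)) * Y ^+ (2 * j) * y1 ^+ 2
   + 2%:R * Y ^+ (2 * j + 1) * y1 * y2 + 2%:R * cheb_conj n j * (cheb_conj n j)^`().
  rewrite /amp_poly !addn1 derivD derivM !deriv_exp -/y1 deriv_Y d1 /=; ring.
have -> : (amp_poly n j.+1)^`() = - ((2 * j + 3)%:R * (2%:R * 'X)) * Y ^+ (2 * j + 2)
  * y2 ^+ 2
   + 2%:R * Y ^+ (2 * j + 2) * y2 * (Y * (cheb R n)^`(j.+3)) + 2%:R * cheb_conj n j.+1
     * (cheb_conj n j.+1)^`().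
  rewrite /amp_poly !addn1 derivD derivM !deriv_exp -/y1 -/y2 deriv_Y.
  have -> : y2^`() = (cheb R n)^`(j.+3) by [].
  have -> : (2 * j.+1).+1 = (2 * j + 3)%N by lia.
  have -> : (2 * j + 3).-1 = (2 * j + 2)%N by lia.
  have -> : (2 * j + 3 = (2 * j + 2).+1)%N by lia.
  rewrite (exprS Y) /=; ring.
rewrite ode dq E1 /amp_poly -/y1 !(exprD Y (2 * j)).
set Z := Y ^+ (2 * j).
ring.
Qed.

(** With $k = j+1$, the coefficient of $(1-x^2)^{-(k+m)}$ in $D$; the last product is $(2m-1)!!$. *)
Definition maj_coef n j m : R :=
  n%:R ^+ 2 * (\prod_(m.+1 <= i < j.+1) (n%:R ^+ 2 - i%:R ^+ 2))
  * 'C(j + m, 2 * m)%:R * (\prod_(i < m) (2 * i + 1)%:R) ^+ 2.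

(** The recurrence that [deriv_amp_poly] imposes on the coefficients, read off at
    $x(1-x^2)^{j-m}$. *)
Lemma maj_coefS n j m : (m <= j)%N ->
  (j.+1 - m)%:R * maj_coef n j.+1 m =
  (n%:R ^+ 2 - j.+1%:R ^+ 2) * (j.+1 + m)%:R * maj_coef n j m.
Proof.
move=> mj; rewrite /maj_coef big_nat_recr //=.
have := mul_bin_down (j.+1 + m) (2 * m).
have -> : (j.+1 + m - 2 * m = j.+1 - m)%N by lia.
rewrite addSn /= => /(congr1 (fun x => x%:R : R)); rewrite !natrM => E.
set c := (\prod_(i < m) _); set d := (\prod_(_ <= i < _) _).
transitivity (n%:R ^+ 2 * d * (n%:R ^+ 2 - j.+1%:R ^+ 2) * ((j.+1 - m)%:R * 'C((j
  + m).+1, 2 * m)%:R) * c ^+ 2).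
  ring.
rewrite -E; ring.
Qed.

Lemma maj_coef_last n j :
  maj_coef n j j = (n%:R * \prod_(i < j) (2 * i + 1)%:R) ^+ 2.
Proof. by rewrite /maj_coef big_geq // addnn -mul2n binn !mulr1 exprMn. Qed.

(** Induction on $j$: [maj_coefS] makes the derivatives agree, and the constant term, the only one
    left at $x = 1$, is fixed by [amp_poly1]. *)
Lemma amp_polyE n j :
  amp_poly n j = \sum_(m < j.+1) (maj_coef n j m)%:P * Y ^+ (j - m).
Proof.
elim: j => [|j IH].
  rewrite big_ord1 maj_coef_last big_ord0 mulr1 mulr1.
  apply: (@deriv_inj_at _ _ 1).
    rewrite derivC /amp_poly /= muln0 add0n expr1 derivD derivM !deriv_exp deriv_Y
      deriv_natl /=.
    transitivity (2%:R * (cheb R n)^`() * (Y * (cheb R n)^`()^`() - 'X * (cheb R n)^`()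
      + n%:R ^+ 2 * cheb R n)); first by ring.
    by rewrite cheb_ode0; ring.
  rewrite amp_poly1 hornerC big_ord0 mulr1.
by [].
apply: (@deriv_inj_at _ _ 1).
  rewrite deriv_amp_poly IH [in RHS]big_ord_recr subnn expr0 mulr1 [RHS]derivD derivC
    addr0.
  rewrite !raddf_sum /= !mulr_sumr -big_split mulr_sumr /=.
  apply: eq_bigr => m _.
  have mj : (m <= j)%N by rewrite -ltnS.
  move: (maj_coefS n j m mj); move: (maj_coef n j.+1 m) (maj_coef n j m) => a b /(congr1
    (@polyC R)).
  rewrite !rmorphM rmorphB !rmorphXn !rmorph_nat /= subSn // => E.
  rewrite !mul_polyC !derivZ !deriv_exp deriv_Y -!mul_polyC /=.
  set Z := Y ^+ (j - m).
  transitivity (- ((n%:R ^+ 2 - j.+1%:R ^+ 2) * (j.+1 + m)%:R * b%:P) * (2%:R * 'X)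
    * Z).
    have -> : Y * (b%:P * (- (2 * 'X) * Y ^+ (j - m).-1 *+ (j - m)))
       = b%:P * (- (2 * 'X) * Z *+ (j - m)).
      (* For $j = m$ the truncated exponent [(j - m).-1] is harmless, since the term has
         multiplicity zero. *)
      rewrite {}/Z; case: (j - m)%N => [|d]; first by rewrite !mulr0n; ring.
      by rewrite (exprS Y) /=; ring.
    rewrite -(mulr_natl _ (j - m)) (natrB _ mj); ring.
  rewrite -E; ring.
rewrite amp_poly1 horner_sum [RHS]big_ord_recr /= [X in _ = X + _]big1 ?add0r.
  by rewrite subnn expr0 mulr1 hornerC maj_coef_last.
move=> m _; rewrite hornerM horner_exp !hornerE expr1n subrr expr0n subn_eq0.
by rewrite leqNgt ltnS -ltnS ltn_ord mulr0.
Qed.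
End Cheb.

(** * The rightmost zero *)

Section RightmostZero.
Variable R : rcfType.
Local Notation Y := (1 - 'X^2 : {poly R}).
Implicit Types n k m : nat.

Lemma cheb_derivn1 n k :
  ((cheb R n)^`(k)).[1] = \prod_(j < k) ((n%:R ^+ 2 - j%:R ^+ 2) / (2 * j + 1)%:R).
Proof.
elim: k => [|k IH]; first by rewrite big_ord0 cheb1.
have k0 : (2 * k + 1)%:R != 0 :> R by rewrite pnatr_eq0 addn1.
apply: (mulfI k0); rewrite cheb_derivn1S big_ord_recr /= -IH.
by rewrite mulrCA [_ * (_ / _)]mulrC divfK // mulrC.
Qed.

Lemma sub_sqr_gt0 n k : (k < n)%N -> 0 < n%:R ^+ 2 - k%:R ^+ 2 :> R.
Proof. by move=> kn; rewrite subr_gt0 ltr_pXn2r ?nnegrE ?ler0n // ltr_nat. Qed.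

Lemma cheb_derivn1_gt0 n k : (k <= n)%N -> 0 < ((cheb R n)^`(k)).[1].
Proof.
move=> kn; rewrite cheb_derivn1; apply: prodr_gt0 => j _.
by rewrite divr_gt0 ?ltr0n ?addn1 // sub_sqr_gt0 // (leq_trans _ kn).
Qed.

Lemma cheb_derivn1_ge0 n k : 0 <= ((cheb R n)^`(k)).[1].
Proof.
have [kn|nk] := leqP k n; first exact/ltW/cheb_derivn1_gt0.
(* Beyond the degree, the product contains the factor $n^2-n^2$. *)
by rewrite cheb_derivn1 (bigD1 (Ordinal nk)) //= subrr !mul0r.
Qed.

(** The Taylor expansion at 1 has nonnegative coefficients and a positive constant term. *)
Lemma cheb_derivn_gt0 n k x :
  (k <= n)%N -> 1 <= x -> 0 < ((cheb R n)^`(k)).[x].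
Proof.
move=> kn x1; set p := (cheb R n)^`(k).
have -> : x = 1 + (x - 1) by rewrite addrC subrK.
rewrite (@nderiv_taylor_wide _ (size p).+1); [|exact: mulrC|by []].
rewrite big_ord_recl expr0 mulr1 nderivn0.
rewrite (lt_le_trans (cheb_derivn1_gt0 _ _ kn)) // lerDl; apply: sumr_ge0 => i _.
rewrite mulr_ge0 ?exprn_ge0 ?subr_ge0 //.
have := cheb_derivn1_ge0 n (bump 0 i + k).
by rewrite /derivn iterD -/(derivn _ _) -/(derivn _ _) -/p nderivn_def hornerMn
  pmulrn_lge0 // fact_gt0.
Qed.

(* Up to the factor $\sin^k\theta$, this is the derivative of
   $\sin^{k+1}\theta\; p(\cos\theta)$ in $\theta$, where $p = T_n^{(k+1)}$. *)
Definition theta_deriv n k : {poly R} :=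
  k.+1%:R * 'X * (cheb R n)^`(k.+1) - Y * (cheb R n)^`(k.+2).

(** With $g = \sin^{k+1}\theta\,T_n^{(k+1)}(\cos\theta)$, this is $g'' = -(n^2 -
    k(k+1)/\sin^2\theta)\,g$ up to the factor $-\sin^{k-1}\theta$. *)
Lemma deriv_theta_deriv n k :
  Y * (theta_deriv n k)^`() - k%:R * 'X * theta_deriv n k =
  (n%:R ^+ 2 * Y - (k * k.+1)%:R) * (cheb R n)^`(k.+1).
Proof.
have ode := cheb_ode R n k.+1.
rewrite /theta_deriv; set p := (cheb R n)^`(k.+1); set p' := (cheb R n)^`(k.+2).
have -> : (k.+1%:R * 'X * p - Y * p')^`() =
  k.+1%:R * (p + 'X * p') + 2%:R * 'X * p' - Y * (cheb R n)^`(k.+3).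
  by rewrite derivB -mulrA deriv_natl !derivM derivX deriv_Y -!derivnS -/p'; ring.
rewrite ode -/p -/p'; ring.
Qed.

Lemma rightmost_zero_lt1 n k (w : R) : (k.+1 < n)%N ->
  root ((cheb R n)^`(k.+1)) w -> w < 1.
Proof.
move=> kn; rewrite ltNge; apply: contraL => w1.
by rewrite /root gt_eqF // cheb_derivn_gt0 // ltnW.
Qed.

(** By parity $-w$ is a zero as well, hence $-w \le w$. *)
Lemma rightmost_zero_ge0 n k (w : R) :
  root ((cheb R n)^`(k)) w ->
  (forall x : R, root ((cheb R n)^`(k)) x -> x <= w) -> 0 <= w.
Proof.
move=> hw hmax; suff /hmax : root ((cheb R n)^`(k)) (- w).
  by rewrite lerNl -subr_ge0 opprK -mulr2n pmulrn_lge0.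
have := congr1 (fun p => p.[w]) (cheb_derivn_parity R n k).
rewrite horner_comp hornerN hornerX hornerM /root => ->.
by move/eqP: hw => ->; rewrite mulr0.
Qed.

(* If the coefficient $n^2 - k(k+1)/\sin^2\theta$ of the equation for
   $g = \sin^{k+1}\theta\,T_n^{(k+1)}(\cos\theta)$ were negative from the zero
   [w] up to [1], then [g] would be convex there and could not vanish at both
   ends. *)
Lemma rightmost_zero_bound n k (w : R) : (0 < k)%N -> (k.+1 < n)%N ->
  root ((cheb R n)^`(k.+1)) w ->
  (forall x : R, root ((cheb R n)^`(k.+1)) x -> x <= w) ->
  (k * k.+1)%:R <= n%:R ^+ 2 * (1 - w ^+ 2).
Proof.
move=> k0 kn hw hmax.
have w1 := rightmost_zero_lt1 _ _ _ kn hw.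
have w0 := rightmost_zero_ge0 _ _ _ hw hmax.
set p := (cheb R n)^`(k.+1) in hw hmax *.
have pn0 x : w < x -> p.[x] != 0.
  by move=> wx; apply/negP => /hmax; rewrite leNgt wx.
have Yh (x : R) : Y.[x] = 1 - x ^+ 2 by rewrite !hornerE.
have Yn0 x : w < x -> x < 1 -> Y.[x] != 0.
  move=> wx x1; rewrite Yh subr_eq0 eq_sym lt_eqF // expr_lt1 // ltW //.
  exact: le_lt_trans w0 wx.
rewrite leNgt; apply/negP => hlt.
set v := theta_deriv n k.
(* Rolle's theorem is applied to $g^2 = (1-x^2)^{k+1}p^2$, squared so as to be a polynomial in $x$;
   it vanishes at $w$ and at 1. *)
have [c cI vc] : {c | c \in `]w, 1[ & v.[c] = 0}.
  have [|c cI] := @poly_rolle R w 1 (Y ^+ k.+1 * p ^+ 2) w1.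
    rewrite !hornerM !horner_exp; move/eqP: hw => ->.
    by rewrite (Yh 1) expr1n subrr expr0n !mul0r mulr0.
  have -> : (Y ^+ k.+1 * p ^+ 2)^`() = - (2%:R * Y ^+ k * p * v).
    rewrite derivM !deriv_exp deriv_Y /v /theta_deriv -/p derivnS -/p /=.
    rewrite (exprS Y); ring.
  move/eqP; rewrite hornerN oppr_eq0 !hornerM !mulf_eq0 horner_exp horner_natr.
  rewrite pnatr_eq0 /= expf_eq0; move: (cI); rewrite in_itv /= => /andP[wc c1].
  rewrite (negPf (Yn0 _ wc c1)) andbF (negPf (pn0 _ wc)) /= => /eqP vc.
  by exists c.
have vn0 : v != 0.
  apply/eqP => /(congr1 (fun q : {poly R} => q.[1])) /eqP.
  rewrite /v /theta_deriv hornerD hornerN !hornerM Yh expr1n subrr mul0r subr0 horner0.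
  by rewrite hornerX horner_natr !mulf_eq0 pnatr_eq0 oner_eq0 /= (negPf (pn0 _ w1)).
(* The last zero of [v] before 1 is taken, so that [v] can be cancelled at any point between [d] and
   1. *)
have [d [wd d1 vd nd]] : exists d, [/\ w < d, d < 1, v.[d] = 0 &
    {in `]d, 1[, forall z, ~~ root v z}].
  have := prev_rootP v w 1; case: prev_rootP => [v0|y _ vy yI hy|x _ _ hx] _.
  - by rewrite v0 eqxx in vn0.
  - by exists y; move: yI; rewrite in_itv /= => /andP[].
  by have := hx _ cI; rewrite /root vc eqxx.
(* This is Rolle for $(dg/d\theta)^2$, which vanishes at 1 because $k > 0$. Its derivative contains
   $n^2(1-x^2)-k(k+1)$, the only factor that could vanish at [e]. *)
have [|e eI] := @poly_rolle R d 1 (Y ^+ k * v ^+ 2) d1.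
  by rewrite !hornerM !horner_exp vd (Yh 1) expr1n subrr expr0n (gtn_eqF k0) !mulr0
    mul0r.
have -> : (Y ^+ k * v ^+ 2)^`() =
    2%:R * Y ^+ k.-1 * v * ((n%:R ^+ 2 * Y - (k * k.+1)%:R) * p).
  rewrite -deriv_theta_deriv -/v derivM !deriv_exp deriv_Y.
  have -> : Y ^+ k = Y * Y ^+ k.-1 by rewrite -exprS prednK.
  rewrite /=; ring.
have [de e1] : d < e /\ e < 1 by move: eI; rewrite in_itv /= => /andP[].
have we := lt_trans wd de.
move/eqP; rewrite !hornerM !mulf_eq0 horner_exp horner_natr.
rewrite pnatr_eq0 /= expf_eq0 (negPf (Yn0 _ we e1)) andbF (negPf (pn0 _ we)) orbF /=.
have := nd _ eI; rewrite /root => /negPf -> /=.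
(* As $e > w \ge 0$, $1-e^2$ does not exceed $1-w^2$, so this factor is negative by [hlt]. *)
rewrite hornerD hornerN hornerM Yh horner_exp !horner_natr.
rewrite lt_eqF // subr_lt0 (le_lt_trans _ hlt) // ler_wpM2l ?exprn_ge0 //.
by rewrite lerD2l lerN2 ler_pXn2r ?nnegrE ?(ltW we) // (le_trans w0) // ltW.
Qed.
End RightmostZero.

(** * Bounding the extremum *)

Section ExtremumBound.
Variable R : rcfType.
Implicit Types n k m j : nat.

(** The Wallis ratio $(2m-1)!!/(2m)!! = \binom{2m}{m}/4^m$. *)
Definition wallis m : R := \prod_(j < m) ((2 * j + 1)%:R / (2 * j + 2)%:R).

Lemma wallisS m : (2 * m + 2)%:R * wallis m.+1 = (2 * m + 1)%:R * wallis m.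
Proof.
rewrite /wallis big_ord_recr /= mulrCA [_ * (_ / _)]mulrC divfK ?pnatr_eq0 ?addn2 //.
exact: mulrC.
Qed.

Lemma wallis_gt0 m : 0 < wallis m.
Proof. by apply: prodr_gt0 => j _; rewrite divr_gt0 ?ltr0n ?addn1 ?addn2. Qed.

(* Gosper summation in [m] of the difference in [k] of the summand
   [2 * k * wallis k * wallis m / (k + m)], divided by [wallis k]. *)
Lemma sum_wallis_telescope k m : (0 < k)%N ->
  \sum_(i < m) ((2 * k + 1)%:R * wallis i / (k + i).+1%:R
              - (2 * k)%:R * wallis i / (k + i)%:R)
  = - 2%:R * m%:R * wallis m / (k + m)%:R.
Proof.
move=> k0; elim: m => [|m IH]; first by rewrite big_ord0 mulr0 !mul0r.
rewrite big_ord_recr /= IH (addnS k m).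
have m0 : (2 * m + 2)%:R != 0 :> R by rewrite pnatr_eq0 addn2.
have -> : wallis m.+1 = (2 * m + 1)%:R * wallis m / (2 * m + 2)%:R.
  by rewrite -wallisS mulrAC mulfV // mul1r.
have x0 : 0 < k%:R :> R by rewrite ltr0n.
have y0 : 0 <= m%:R :> R by [].
have -> : (k + m).+1%:R = k%:R + m%:R + 1 :> R by rewrite -addn1 !natrD.
have -> : (k + m)%:R = k%:R + m%:R :> R by rewrite natrD.
have -> : (2 * m + 2)%:R = 2 * m%:R + 2 :> R by rewrite natrD natrM.
have -> : (2 * m + 1)%:R = 2 * m%:R + 1 :> R by rewrite natrD natrM.
have -> : (2 * k + 1)%:R = 2 * k%:R + 1 :> R by rewrite natrD natrM.
have -> : m.+1%:R = m%:R + 1 :> R by rewrite -natr1.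
rewrite natrM; field; apply/and3P; split; apply/lt0r_neq0; lra.
Qed.

(** Induction on $k$: [sum_wallis_telescope] at equal arguments links the sums with denominators
    $k+1+m$ and $k+2+m$ over the same range; the one new term is absorbed by [wallisS]. *)
Lemma sum_wallis k :
  \sum_(m < k.+1) wallis m / (k.+1 + m)%:R = (2 * k.+1%:R * wallis k.+1)^-1.
Proof.
have w0 m : wallis m != 0 by rewrite gt_eqF ?wallis_gt0.
rewrite -[RHS]mul1r; apply: (canRL (mulfK _)); first by rewrite !mulf_neq0 // pnatr_eq0.
elim: k => [|k IH].
  by rewrite big_ord1 /wallis big_ord0 big_ord1 /= addn0; field.
have := sum_wallis_telescope k.+1 k.+1 isT.
rewrite sumrB.
under eq_bigr do rewrite -mulrA.
under [X in _ - X]eq_bigr do rewrite -mulrA.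
rewrite -!mulr_sumr [in X in _ -> X]big_ord_recr /=; move: IH.
set A := \sum_(m < _) _ / (k.+1 + m)%:R; set B := \sum_(m < _) _ / _;
  set u := wallis k.+1.
have E := wallisS k.+1; rewrite -/u in E.
have x0 : 0 < k.+1%:R :> R by rewrite ltr0n.
have -> : (2 * k.+1 + 1)%:R = 2 * k.+1%:R + 1 :> R by rewrite natrD natrM.
have -> : (2 * k.+1)%:R = 2 * k.+1%:R :> R by rewrite natrM.
have -> : (k.+1 + k.+1)%:R = 2 * k.+1%:R :> R by rewrite natrD; ring.
have -> : (k.+2 + k.+1)%:R = 2 * k.+1%:R + 1 :> R by rewrite !natrD -!natr1; ring.
have {}E : 2 * k.+2%:R * wallis k.+2 = (2 * k.+1%:R + 1) * u.
  have -> : 2 * k.+2%:R = (2 * k.+1 + 2)%:R :> R by rewrite -natrM; congr (_%:R); lia.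
  by rewrite E natrD natrM.
move: k.+1%:R x0 E => x x0 -> IH.
have -> : - 2 * x * u / (2 * x) = - u by field; apply/lt0r_neq0; lra.
move=> T.
transitivity (u * ((2 * x + 1) * B) + u ^+ 2); first by field; apply/lt0r_neq0; lra.
rewrite (_ : (2 * x + 1) * B = 2 * x * A - u); last by lra.
by rewrite -[RHS]IH; ring.
Qed.

(** The ratio of neighbouring coefficients in $m$, cleared of denominators; it drives the induction
    in [maj_coef_le]. *)
Lemma maj_coefSr n j m : (m < j)%N ->
  (2 * m + 2)%:R * (n%:R ^+ 2 - m.+1%:R ^+ 2) * maj_coef R n j m.+1 =
  ((j.+1 + m) * (j - m) * (2 * m + 1))%:R * maj_coef R n j m.
Proof.
move=> mj; rewrite /maj_coef [in RHS]big_ltn // [in LHS]big_ord_recr /=.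
have E1 := mul_bin_diag (j + m).+1 (2 * m).+1.
have E2 := mul_bin_left (j + m) (2 * m).
have E : ((2 * m + 2) * (2 * m + 1) * 'C(j + m.+1, 2 * m.+1) = (j.+1 + m) * (j - m)
  * 'C(j + m, 2 * m))%N.
  have e1 : (j + m - 2 * m = j - m)%N by lia.
  have e2 : (2 * m.+1 = (2 * m).+2)%N by lia.
  rewrite e1 in E2; rewrite (addnS j m) e2.
  transitivity ((2 * m).+1 * ((2 * m).+2 * 'C((j + m).+1, (2 * m).+2)))%N;
    first by rewrite addn2 addn1 mulnA [in RHS](mulnC (2 * m).+1).
  by rewrite -E1 /= mulnCA E2 mulnA.
move/(congr1 (fun x => x%:R : R)): E; rewrite !natrM => E.
set c := (\prod_(i < m) _); set d := (\prod_(_ <= i < _) _).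
transitivity (n%:R ^+ 2 * d * (n%:R ^+ 2 - m.+1%:R ^+ 2) * ((2 * m + 2)%:R * (2 * m
  + 1)%:R * 'C(j + m.+1, 2 * m.+1)%:R) * c ^+ 2 * (2 * m + 1)%:R).
  by ring.
rewrite E; ring.
Qed.

Lemma maj_coef_ge0 n j m : (j < n)%N -> 0 <= maj_coef R n j m.
Proof.
move=> jn; rewrite /maj_coef big_nat_cond.
rewrite !mulr_ge0 ?exprn_ge0 ?prodr_ge0 // => i /andP[/andP[_ ij] _].
by rewrite ltW // sub_sqr_gt0 // (leq_trans _ jn).
Qed.

(** The two sides agree at $m = 0$, and passing from $m$ to $m+1$ multiplies the left side by no
    more than the right. *)
Lemma maj_coef_le n j m : (j < n)%N -> (m <= j)%N ->
  maj_coef R n j m * (n%:R ^+ 2 / j.+1%:R ^+ 2) ^+ m <=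
  (\prod_(i < j.+1) (n%:R ^+ 2 - i%:R ^+ 2)) * (j.+1%:R * wallis m / (j.+1 + m)%:R).
Proof.
move=> jn; set N := \prod_(i < _) _; set t := _ / _ : R.
elim: m => [|m IH] mj.
  rewrite mulr1 addn0 /wallis big_ord0 mulr1 divff ?pnatr_eq0 // mulr1.
  rewrite /maj_coef muln0 bin0 big_ord0 expr1n !mulr1 /N -(big_mkord xpredT (fun i
    => n%:R ^+ 2 - i%:R ^+ 2 : R)).
  by rewrite [leRHS]big_ltn // mulr0n expr0n subr0.
have mj' := ltnW mj; have {IH} IH := IH mj'.
have l0 : 0 < n%:R ^+ 2 - m.+1%:R ^+ 2 :> R by rewrite sub_sqr_gt0 // (leq_trans _ jn).
have p0 : 0 < (2 * m + 2)%:R :> R by rewrite ltr0n addn2.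
rewrite -(ler_pM2l (mulr_gt0 p0 l0)) mulrA maj_coefSr // exprS.
have q0 : 0 < (j.+1 + m.+1)%:R :> R by rewrite ltr0n.
have q1 : 0 < (j.+1 + m)%:R :> R by rewrite ltr0n.
have N0 : 0 <= N.
  by apply: prodr_ge0 => i _; rewrite ltW // sub_sqr_gt0 // (leq_trans _ jn).
(* With $k = j+1$ this says $(n/k)^2(k^2-(m+1)^2) \le n^2-(m+1)^2$, true since $k \le n$. *)
have ht : (j - m)%:R * t <= (n%:R ^+ 2 - m.+1%:R ^+ 2) / (j.+1 + m.+1)%:R.
  rewrite ler_pdivlMr // /t mulrA mulrAC ler_pdivrMr ?exprn_gt0 ?ltr0n //.
  have -> : (j - m)%:R = j.+1%:R - m.+1%:R :> R by rewrite natrB // -!natr1; ring.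
  have jn' : j.+1%:R ^+ 2 <= n%:R ^+ 2 :> R by rewrite lerXn2r ?nnegrE ?ler0n //
    ler_nat.
  have m0 : 0 <= m.+1%:R ^+ 2 :> R by rewrite exprn_ge0.
  rewrite natrD; move: j.+1%:R m.+1%:R n%:R jn' m0 => x y z xz y0; nra.
have -> : ((j.+1 + m) * (j - m) * (2 * m + 1))%:R * maj_coef R n j m * (t * t ^+ m) =
  (j.+1 + m)%:R * (2 * m + 1)%:R * ((j - m)%:R * t) * (maj_coef R n j m * t ^+ m).
  by rewrite !natrM; ring.
apply: (@le_trans _ _ ((j.+1 + m)%:R * (2 * m + 1)%:R * ((j - m)%:R * t) *
   (N * (j.+1%:R * wallis m / (j.+1 + m)%:R)))).
  by rewrite ler_wpM2l // !mulr_ge0 // ?divr_ge0 ?exprn_ge0.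
apply: (@le_trans _ _ ((j.+1 + m)%:R * (2 * m + 1)%:R * ((n%:R ^+ 2 - m.+1%:R ^+ 2)
  / (j.+1 + m.+1)%:R) *
   (N * (j.+1%:R * wallis m / (j.+1 + m)%:R)))).
  rewrite ler_wpM2r // ?ler_wpM2l ?mulr_ge0 ?invr_ge0 // ltW ?wallis_gt0 //.
have -> : wallis m.+1 = (2 * m + 1)%:R * wallis m / (2 * m + 2)%:R.
  by rewrite -wallisS mulrAC mulfV ?mul1r // gt_eqF.
move: q0 q1 p0; move: (j.+1 + m.+1)%:R (j.+1 + m)%:R (2 * m + 2)%:R (2 * m + 1)%:R
  => a b c d a0 b0 c0.
rewrite le_eqVlt; apply/orP; left; apply/eqP.
by field; rewrite !gt_eqF.
Qed.

Lemma prod_sub_sqr_gt0 n k : (k <= n)%N ->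
  0 < \prod_(i < k) (n%:R ^+ 2 - i%:R ^+ 2) :> R.
Proof.
by move=> kn; apply: prodr_gt0 => i _; rewrite sub_sqr_gt0 // (leq_trans _ kn).
Qed.

(** Once the square of [cheb_conj] is dropped, a polynomial in $s = 1/(1-w^2)$ with nonnegative
    coefficients remains, so $s$ may be raised to $n^2/k^2$. Then [maj_coef_le] applies termwise and
    [sum_wallis] evaluates the sum. *)
Lemma cheb_derivn_sqr_le n k (w : R) : (0 < k <= n)%N ->
  k%:R ^+ 2 <= n%:R ^+ 2 * (1 - w ^+ 2) ->
  ((cheb R n)^`(k)).[w] ^+ 2 <=
    (n%:R / k%:R) ^+ (2 * k) * (\prod_(i < k) (n%:R ^+ 2 - i%:R ^+ 2)) / (2 * wallis k).
Proof.
case: k => [//|j] /= jn hw.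
set y := _.[w]; set N := \prod_(i < _) _; set s := (1 - w ^+ 2)^-1.
have n0 : 0 < n%:R ^+ 2 :> R by rewrite exprn_gt0 // ltr0n (leq_trans _ jn).
have j0 : 0 < j.+1%:R ^+ 2 :> R by rewrite exprn_gt0 // ltr0n.
have Y0 : 0 < 1 - w ^+ 2 by rewrite -(pmulr_rgt0 _ n0) (lt_le_trans j0).
have st : s <= n%:R ^+ 2 / j.+1%:R ^+ 2.
  by rewrite ler_pdivlMr // mulrC ler_pdivrMr.
have s0 : 0 <= s by rewrite invr_ge0 ltW.
have := congr1 (fun p : {poly R} => p.[w]) (amp_polyE R n j).
rewrite /amp_poly horner_sum hornerD hornerM !horner_exp -/y.
have -> : (1 - 'X^2 : {poly R}).[w] = 1 - w ^+ 2 by rewrite !hornerE.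
under eq_bigr do rewrite hornerM horner_exp hornerC.
have -> : (1 - 'X^2 : {poly R}).[w] = 1 - w ^+ 2 by rewrite !hornerE.
move=> amp.
have yle : (1 - w ^+ 2) ^+ (2 * j + 1) * y ^+ 2 <= \sum_(m < j.+1) maj_coef R n j m
  * (1 - w ^+ 2) ^+ (j - m).
  by rewrite -amp lerDl sqr_ge0.
have {yle} yle : y ^+ 2 <= \sum_(m < j.+1) maj_coef R n j m * s ^+ (j.+1 + m).
  have sp : 0 <= s ^+ (2 * j + 1) by rewrite exprn_ge0.
  have := ler_wpM2l sp yle; rewrite mulrA -exprMn mulVf ?gt_eqF // expr1n mul1r.
  move=> /le_trans; apply; rewrite mulr_sumr le_eqVlt; apply/orP; left; apply/eqP.
  apply: eq_bigr => m _; have mj : (m <= j)%N by rewrite -ltnS.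
  have -> : (2 * j + 1 = j.+1 + m + (j - m))%N by lia.
  rewrite (exprD s _ (j - m)) mulrCA; congr (_ * _).
  by rewrite -mulrA -exprMn mulVf ?gt_eqF // expr1n mulr1.
apply: (le_trans yle).
have -> : (2 * wallis j.+1)^-1 = \sum_(m < j.+1) j.+1%:R * wallis m / (j.+1 + m)%:R.
  under eq_bigr do rewrite -mulrA.
  by rewrite -mulr_sumr sum_wallis; field; rewrite !gt_eqF ?wallis_gt0 ?ltr0n.
rewrite mulr_sumr ler_sum // => m _.
have mj : (m <= j)%N by rewrite -ltnS.
rewrite -[_ * N * _]mulrA exprM expr_div_n.
apply: (@le_trans _ _ (maj_coef R n j m * (n%:R ^+ 2 / j.+1%:R ^+ 2) ^+ (j.+1 + m))).
  by rewrite ler_wpM2l ?maj_coef_ge0 // lerXn2r ?nnegrE ?divr_ge0 ?exprn_ge0.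
by rewrite exprD mulrCA ler_wpM2l ?exprn_ge0 ?divr_ge0 ?exprn_ge0 // maj_coef_le.
Qed.

(** Up to $(2k)!$ the binomial is $(n+k)(n+k-1)\cdots(n-k+1)$; pairing $n+i$ with $n-i$ for $0 < i <
    k$ leaves $n$ and $n+k$ over. *)
Lemma bin_prod_sub_sqr n k : (k <= n)%N ->
  n%:R * 'C(n + k, n - k)%:R * \prod_(i < k) ((2 * i + 1)%:R * (2 * i + 2)%:R)
   = (n + k)%:R * \prod_(i < k) (n%:R ^+ 2 - i%:R ^+ 2) :> R.
Proof.
move=> kn.
have -> : 'C(n + k, n - k) = 'C(n + k, 2 * k).
  by rewrite -[RHS]bin_sub; [congr 'C(_, _)|]; lia.
have -> : \prod_(i < k) ((2 * i + 1)%:R * (2 * i + 2)%:R) = (2 * k)`!%:R :> R.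
  elim: (k) => [|m IH]; first by rewrite big_ord0 muln0.
  rewrite big_ord_recr /= IH.
  have -> : (2 * m.+1 = (2 * m).+2)%N by lia.
  by rewrite !factS !natrM addn2 addn1; ring.
rewrite -mulrA -natrM bin_ffact.
elim: k kn => [|k IH] kn; first by rewrite big_ord0 !mulr1 addn0.
have -> : (2 * k.+1 = (2 * k).+2)%N by lia.
rewrite (addnS n k) ffactSS ffactnSr big_ord_recr /=.
have -> : (n + k - 2 * k = n - k)%N by lia.
have {}IH := IH (ltnW kn); rewrite !natrM (natrB _ (ltnW kn)).
transitivity ((n + k).+1%:R * (n%:R - k%:R) * (n%:R * ((n + k) ^_ (2 * k))%:R) : R);
  first by ring.
rewrite IH natrD; ring.
Qed.
End ExtremumBound.

(** * Stirling-type estimates *)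

Section RealAnalysis.
Variable R : realType.
Import numFieldNormedType.Exports.

Lemma is_derive_le (f df : R -> R) (a b : R) : a <= b ->
  (forall x, a <= x <= b -> is_derive x 1 f (df x)) ->
  (forall x, a < x < b -> 0 <= df x) -> f a <= f b.
Proof.
rewrite le_eqVlt => /predU1P[->//|ab] fdf df0.
have [x||c cab] := @MVT R f df a b ab.
- by rewrite in_itv /= => /andP[ax xb]; apply: fdf; rewrite !ltW.
- by apply: derivable_within_continuous => x; rewrite in_itv /= => /fdf[].
rewrite in_itv /= in cab.
by move=> E; rewrite -subr_ge0 E mulr_ge0 ?df0 // subr_ge0 ltW.
Qed.

(** The derivative $1-(1-t)e^t$ of the difference is nonnegative because $e^{-t} \ge 1-t$. *)
Lemma expR_pade_le (x : R) : 0 <= x -> (2 - x) * expR x <= 2 + x.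
Proof.
move=> x0; rewrite -subr_ge0.
have := @is_derive_le (fun t => 2 + t - (2 - t) * expR t)
  (fun t => 1 - (1 - t) * expR t) 0 x x0.
rewrite expR0 !addr0 subr0 mulr1 subrr; apply=> t.
  by move=> _; apply: is_derive_eq; rewrite /GRing.scale /=; ring.
by move=> _; rewrite subr_ge0 -ler_pdivlMr ?expR_gt0 // mul1r -expRN expR_ge1Dx.
Qed.

(* The exponent is the Pade approximant $x(6+x)/(6+4x)$ of $\ln(1+x)$, in partial
   fractions. *)
Lemma le1Dx_expR_pade (x : R) : 0 <= x ->
  1 + x <= expR (x / 4 + 9 / 8 - 27 / 4 / (6 + 4 * x)).
Proof.
move=> x0; have px : 0 < 1 + x by lra.
rewrite -ler_ln ?posrE ?expR_gt0 // expRK -subr_ge0.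
have := @is_derive_le (fun t => t / 4 + 9 / 8 - 27 / 4 / (6 + 4 * t) - ln (1 + t))
  (fun t => 1 / 4 + 27 / (6 + 4 * t) ^+ 2 - (1 + t)^-1) 0 x x0.
rewrite !mulr0 mul0r !addr0 ln1 subr0 (_ : _ - _ = 0) ?add0r; last by field.
apply=> t tx.
  have t0 : 0 < 1 + t by lra.
  have t1 : 6 + 4 * t != 0 by apply/lt0r_neq0; lra.
  have d0 : is_derive t 1 (fun t : R => t / 4 + 9 / 8) (1 / 4).
    by apply: is_derive_eq; rewrite /GRing.scale /=; ring.
  have d1 : is_derive t 1 (fun t : R => 1 + t) 1.
    by apply: is_derive_eq; rewrite add0r mulr1.
  have d2 : is_derive t 1 (fun t : R => 6 + 4 * t) 4.
    by apply: is_derive_eq; rewrite /GRing.scale /=; ring.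
  have dln := @is_derive1_comp R (@ln R) _ t _ _ (is_derive1_ln t0) d1.
  have dV := is_deriveZ (27 / 4) (@is_deriveV R _ t _ _ t1 d2).
  apply: (is_derive_eq (is_deriveB (is_deriveB d0 dV) dln)).
  by rewrite /GRing.scale /=; field; rewrite t1 lt0r_neq0.
have t0 : 0 < 1 + t by lra.
have -> : 1 / 4 + 27 / (6 + 4 * t) ^+ 2 - (1 + t)^-1
   = t ^+ 3 / ((1 + t) * (3 + 2 * t) ^+ 2).
  by field; rewrite !lt0r_neq0 //; lra.
by rewrite divr_ge0 ?mulr_ge0 ?exprn_ge0 //; lra.
Qed.

Lemma sin_ge_mul_cos (x : R) : 0 <= x <= 1 -> x * cos x <= sin x.
Proof.
move=> /andP[x0 x1]; rewrite -subr_ge0.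
have := @is_derive_le (fun t => sin t - t * cos t) (fun t => t * sin t) 0 x x0.
rewrite sin0 mul0r subr0; apply=> t tx.
  by apply: is_derive_eq; rewrite /GRing.scale /=; ring.
rewrite mulr_ge0 //; first by lra.
by rewrite ltW // sin2_gt0 //; lra.
Qed.

(** From $\tan\frac12 \ge \frac12$ and $\tan\frac13 \ge \frac13$ the addition formulas give
    $\tan\frac56 \ge 1$, hence $\cos\frac53 \le 0$; but $\pi > 10/3$ would make $\cos\frac53$
    positive. *)
Lemma pi_le : pi <= 10 / 3 :> R.
Proof.
have s1 := @sin_ge_mul_cos 2^-1.
have s2 := @sin_ge_mul_cos 3^-1.
have c1 : 0 < cos (2^-1 : R).
  by apply: cos_gt0_pihalf; have := pi_ge2 R; lra.
have c2 : 0 < cos (3^-1 : R).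
  by apply: cos_gt0_pihalf; have := pi_ge2 R; lra.
have {}s1 : 2^-1 * cos 2^-1 <= sin (2^-1 : R) by apply: s1; lra.
have {}s2 : 3^-1 * cos 3^-1 <= sin (3^-1 : R) by apply: s2; lra.
rewrite leNgt; apply/negP => hpi.
have c0 : 0 < cos (2^-1 + 3^-1 + (2^-1 + 3^-1) : R).
  by apply: cos_gt0_pihalf; lra.
have c3 : 0 < cos (2^-1 + 3^-1 : R).
  by apply: cos_gt0_pihalf; lra.
move: c0; rewrite cosD; move: c3; rewrite cosD sinD.
move: (cos 2^-1) (cos 3^-1) (sin 2^-1) (sin 3^-1) s1 s2 c1 c2 => a b c d *.
have : a * b * (5 / 6) <= c * b + a * d by nra.
have : a * b - c * d <= a * b * (5 / 6) by nra.
nra.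
Qed.

End RealAnalysis.

(** * Bounds for the normalised factorial *)

Section Stirling.
Variable R : realType.

Definition stirling N : R :=
  (N`!%:R * expR N%:R / N%:R ^+ N) ^+ 2 / N%:R.

Lemma stirlingS N : (0 < N)%N ->
  stirling N.+1 * (N.+1%:R / N%:R) ^+ (2 * N + 1) = expR 2 * stirling N.
Proof.
move=> N0; have n0 : N%:R != 0 :> R by rewrite pnatr_eq0 -lt0n.
have n1 : N.+1%:R != 0 :> R by rewrite pnatr_eq0.
have p0 : N%:R ^+ N != 0 :> R by rewrite expf_neq0.
have p1 : N.+1%:R ^+ N != 0 :> R by rewrite expf_neq0.
rewrite /stirling factS natrM addn1 (exprS _ (2 * N)) [(2 * N)%N]mulnC exprM (expr_div_n
  _ _ N) (exprS _ N).
have -> : expR N.+1%:R = expR N%:R * expR 1 :> R by rewrite -natr1 expRD.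
have -> : expR 2 = expR 1 ^+ 2 :> R by rewrite -expRM_natl mulr1.
move: (N%:R ^+ N) (N.+1%:R ^+ N) p0 p1 => a b a0 b0.
move: (N.+1%:R : R) (N%:R : R) n0 n1 => x y *.
by field; rewrite ?a0 ?b0 //; apply/and4P; split.
Qed.

Lemma stirling_gt0 N : (0 < N)%N -> 0 < stirling N.
Proof.
move=> N0; rewrite /stirling divr_gt0 ?exprn_gt0 ?divr_gt0 ?mulr_gt0 ?expR_gt0
  ?exprn_gt0 //.
all: by rewrite ltr0n // fact_gt0.
Qed.

Lemma stirling_decrS N : (0 < N)%N -> stirling N.+1 <= stirling N.
Proof.
move=> N0; have n0 : 0 < N%:R :> R by rewrite ltr0n.
rewrite -(ler_pM2l (expR_gt0 2)) -(stirlingS N) // mulrC ler_wpM2l //.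
  exact/ltW/stirling_gt0.
(* For this [x], $(2+x)/(2-x) = (N+1)/N$ and $(2N+1)x = 2$, so [expR_pade_le] yields $e^2 \le
   (1+1/N)^{2N+1}$. *)
set x : R := 2 / (2 * N + 1)%:R.
have N1 : (2 * N + 1)%:R = 2 * N%:R + 1 :> R by rewrite natrD natrM.
have -> : 2 = (2 * N + 1)%:R * x :> R.
  by rewrite /x mulrC divfK // N1 lt0r_neq0 //; lra.
rewrite expRM_natl lerXn2r ?nnegrE ?expR_ge0 ?divr_ge0 //.
have x0 : 0 <= x by rewrite divr_ge0.
have := expR_pade_le R _ x0.
have -> : 2 - x = 4 * N%:R / (2 * N + 1)%:R.
  by rewrite /x N1; field; rewrite lt0r_neq0 //; lra.
have -> : 2 + x = 4 * N.+1%:R / (2 * N + 1)%:R.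
  by rewrite /x N1 -natr1; field; rewrite lt0r_neq0 //; lra.
rewrite mulrAC ler_pM2r ?invr_gt0; last by rewrite N1; lra.
by rewrite ler_pdivlMr // -mulrA ler_pM2l // mulrC.
Qed.

(** In other words, $s_N e^{-1/(5N)}$ is nondecreasing. The constant $1/5$ is the least for which
    the bound [le1Dx_expR_pade] suffices from $N = 1$ on, where it is tight. *)
Lemma stirling_incrS N : (0 < N)%N ->
  stirling N <= stirling N.+1 * expR (5^-1 / N%:R - 5^-1 / N.+1%:R).
Proof.
move=> N0; have n0 : 0 < N%:R :> R by rewrite ltr0n.
rewrite -(ler_pM2l (expR_gt0 2)) -(stirlingS N) // mulrCA ler_wpM2l //.
  exact/ltW/stirling_gt0.
rewrite -expRD.
have -> : N.+1%:R / N%:R = 1 + N%:R^-1 :> R.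
  by rewrite -natr1 mulrDl mul1r divff // gt_eqF.
have x0 : 0 <= N%:R^-1 :> R by rewrite invr_ge0.
have := le1Dx_expR_pade R _ x0; set h := (_ / 4 + _ - _) => hle.
apply: (@le_trans _ _ (expR h ^+ (2 * N + 1))).
  by rewrite lerXn2r ?nnegrE ?expR_ge0 // addr_ge0.
rewrite -expRM_natl ler_expR -subr_ge0 /h.
have -> : (2 * N + 1)%:R = 2 * N%:R + 1 :> R by rewrite natrD natrM.
have -> : N.+1%:R = N%:R + 1 :> R by rewrite -natr1.
move: (N%:R : R) n0 (ler1n R N) => x x0'.
rewrite N0 => x1.
have -> : 2 + (5^-1 / x - 5^-1 / (x + 1)) - (2 * x + 1) * (x^-1 / 4 + 9 / 8 - 27 / 4
  / (6 + 4 / x))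
  = (x - 1) / (5 * x * (x + 1) * (6 * x + 4)).
  by field; rewrite !lt0r_neq0 //; lra.
by rewrite divr_ge0 ?mulr_ge0 //; lra.
Qed.

Lemma stirling_ge N : (0 < N)%N -> expR (9 / 5) <= stirling N.
Proof.
(* The induction starts from $s_1 = e^2$; the exponent $9/5$ is $2-1/5$. *)
move=> N0; suff : expR 2 <= stirling N * expR (5^-1 - 5^-1 / N%:R).
  have n0 : 0 < N%:R :> R by rewrite ltr0n.
  rewrite -ler_pdivrMr ?expR_gt0 // -expRN -expRD; apply: le_trans.
  have h : 0 <= 5^-1 / N%:R :> R by rewrite divr_ge0.
  by rewrite ler_expR; lra.
elim: N N0 => [//|[|N] IH _].
  by rewrite /stirling (_ : 1`! = 1%N) // mul1r expr1 !divr1 subrr expR0 mulr1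
    -expRM_natl mulr1.
apply: (le_trans (IH isT)).
apply: (le_trans (ler_wpM2r (expR_ge0 _) (stirling_incrS N.+1 isT))).
rewrite -mulrA -expRD ler_wpM2l ?(ltW (stirling_gt0 _ _)) // ler_expR.
by move: (5^-1 / N.+1%:R) (5^-1 / N.+2%:R) => u v; lra.
Qed.

Lemma stirling_le N : (2 <= N)%N -> stirling N <= expR 4 / 8.
Proof.
elim: N => [//|N IH]; rewrite leq_eqVlt => /predU1P[<-|N2].
  have -> : expR 4 = expR 2 ^+ 2 :> R by rewrite -expRM_natl; congr expR; ring.
  by rewrite /stirling le_eqVlt; apply/orP; left; apply/eqP; rewrite (_ : 2`! = 2%N) //;
    field.
exact: le_trans (stirling_decrS _ (ltnW N2)) (IH N2).
Qed.

(** Equivalent to $(e^4/8)^2 \le e^{9/5}\,e^4/(2\pi)$, the numerical core of [stirling_ratio_le]. *)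
Lemma two_pi_expR_le : 2 * pi * expR (11 / 5) <= 64 :> R.
Proof.
(* Cutting $11/5$ into eight equal parts makes the Pade bound sharp enough:
   $2\cdot\frac{10}{3}\cdot\frac{48}{5} = 64$. *)
have e : expR (11 / 40) <= 91 / 69 :> R.
  have x0 : 0 <= 11 / 40 :> R by lra.
  have := expR_pade_le R _ x0; lra.
have -> : expR (11 / 5) = expR (11 / 40) ^+ 8 :> R.
  by rewrite -expRM_natl; congr expR; field.
have {e} e : expR (11 / 40) ^+ 8 <= 48 / 5 :> R.
  apply: (@le_trans _ _ ((91 / 69) ^+ 8)); last by lra.
  by rewrite lerXn2r ?nnegrE ?expR_ge0.
have := pi_le R; have := pi_gt0 R.
have : 0 < expR (11 / 40) ^+ 8 :> R by rewrite exprn_gt0 ?expR_gt0.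
nra.
Qed.

Lemma stirling_ratio_le a b : (2 <= a)%N -> (2 <= b)%N ->
  stirling a * stirling b / stirling (a + b) <= expR 4 / (2 * pi).
Proof.
move=> a2 b2.
have c0 : (0 < a + b)%N by lia.
rewrite ler_pdivrMr ?stirling_gt0 //.
apply: (@le_trans _ _ (expR 4 / 8 * (expR 4 / 8))).
  by rewrite ler_pM ?stirling_le // ltW // stirling_gt0 // ltnW.
apply: (@le_trans _ _ (expR 4 / (2 * pi) * expR (9 / 5))); last first.
  by rewrite ler_wpM2l ?stirling_ge // divr_ge0 ?expR_ge0 // mulr_ge0 // pi_ge0.
rewrite [leRHS]mulrAC ler_pdivlMr ?mulr_gt0 ?pi_gt0 //.
have -> : expR 4 / 8 * (expR 4 / 8) * (2 * pi) =
   expR 4 * expR (9 / 5) * (2 * pi * expR (11 / 5)) / 64 :> R.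
  have -> : expR 4 = expR (9 / 5) * expR (11 / 5) :> R by rewrite -expRD; congr expR;
    field.
  by field.
rewrite ler_pdivrMr // ler_wpM2l ?mulr_ge0 ?expR_ge0 //.
exact: two_pi_expR_le.
Qed.

Lemma fact_sqr_stirling N : (0 < N)%N ->
  N`!%:R ^+ 2 = stirling N * N%:R * (N%:R ^+ N) ^+ 2 / expR N%:R ^+ 2.
Proof.
move=> N0; have n0 : N%:R != 0 :> R by rewrite pnatr_eq0 -lt0n.
rewrite /stirling divfK // expr_div_n divfK ?expf_neq0 //.
by rewrite exprMn mulfK // expf_neq0 // gt_eqF ?expR_gt0.
Qed.
End Stirling.

(** * The two inequalities *)

Lemma tau_sqr_le (R : realType) n k (w : R) : (0 < k)%N -> (k.+1 < n)%N ->
  root ((cheb R n)^`(k.+1)) w ->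
  (forall x : R, root ((cheb R n)^`(k.+1)) x -> x <= w) ->
  tau n k w ^+ 2 <= 2^-1 * (1 + k%:R / n%:R) * (n%:R / k%:R) ^+ (2 * k)
         / ('C(n + k, n - k))%:R.
Proof.
move=> k0 kn hw hmax.
have kn' : (k <= n)%N by lia.
have n0 : n%:R != 0 :> R by rewrite pnatr_eq0; lia.
have C0 : ('C(n + k, n - k))%:R != 0 :> R by rewrite pnatr_eq0 -lt0n bin_gt0; lia.
have k2 : k%:R ^+ 2 <= n%:R ^+ 2 * (1 - w ^+ 2).
  apply: le_trans (rightmost_zero_bound _ _ _ _ k0 kn hw hmax).
  by rewrite -natrX ler_nat expnS expn1 leq_mul.
have kn2 : (0 < k <= n)%N by rewrite k0.
have := cheb_derivn_sqr_le R _ _ _ kn2 k2.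
have := bin_prod_sub_sqr R _ _ kn'.
rewrite /tau (expr_div_n _ _ 2) real_normK ?num_real // cheb_derivn1 !prodf_div /wallis
  prodf_div.
rewrite big_split /=.
have := prod_sub_sqr_gt0 R _ _ kn'.
set N := \prod_(i < k) (n%:R ^+ 2 - _); set o := \prod_(i < k) (2 * i + 1)%:R.
set e := \prod_(i < k) (2 * i + 2)%:R.
have o0 : 0 < o by apply: prodr_gt0 => i _; rewrite ltr0n addn1.
have e0 : 0 < e by apply: prodr_gt0 => i _; rewrite ltr0n addn2.
move=> N0 E yle.
rewrite ler_pdivrMr ?exprn_gt0 ?divr_gt0 //.
(* What remains is an equality, with [E] expressing $n+k$ through the binomial coefficient and the
   products. *)
apply: (le_trans yle); rewrite le_eqVlt; apply/orP; left; apply/eqP.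
have -> : 1 + k%:R / n%:R = (n + k)%:R / n%:R :> R by rewrite natrD mulrDl divff.
have -> : (n + k)%:R = n%:R * 'C(n + k, n - k)%:R * (o * e) / N by rewrite E mulfK //
  gt_eqF.
by field; rewrite n0 C0 !gt_eqF.
Qed.

(** Both sides are squared and the factorials expressed through $s_N$. The exponentials cancel
    because $2k+(n-k) = n+k$, leaving [stirling_ratio_le] times a common factor. *)
Lemma bin_bound_le (R : realType) n k : (0 < k)%N -> (k.+1 < n)%N ->
  2^-1 * (1 + k%:R / n%:R) * (n%:R / k%:R) ^+ (2 * k)
         / ('C(n + k, n - k))%:R
    <= (expR 2 / (2 * Num.sqrt pi)) * Num.sqrt (k%:R : R)
       * Num.sqrt (1 - (k%:R / n%:R) ^+ 2)
       * (2 * n%:R) ^+ (2 * k) * ((n - k)%:R) ^+ (n - k)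
       / ((n + k)%:R) ^+ (n + k).
Proof.
move=> k0 kn.
have a2 : (2 <= 2 * k)%N by lia.
have b2 : (2 <= n - k)%N by lia.
have kn0 : (k <= n)%N by lia.
have [a0 b0 c0] : [/\ 0 < 2 * k, 0 < n - k & 0 < n + k]%N by split; lia.
have abc : (2 * k + (n - k) = n + k)%N by lia.
have S := stirling_ratio_le R _ _ a2 b2; rewrite abc in S.
have Fa := fact_sqr_stirling R _ a0; have Fb := fact_sqr_stirling R _ b0.
have Fc := fact_sqr_stirling R _ c0.
have x0 : 0 < k%:R :> R by rewrite ltr0n.
have y0 : 0 < n%:R :> R by rewrite ltr0n; lia.
have xy : k%:R < n%:R :> R by rewrite ltr_nat; lia.
have bin : ('C(n + k, n - k))%:R = (n + k)`!%:R / ((n - k)`!%:R * (2 * k)`!%:R) :> R.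
  have h : (n - k <= n + k)%N by lia.
  have := bin_fact h; have -> : (n + k - (n - k) = 2 * k)%N by lia.
  move=> <-; rewrite natrM natrM mulfK // mulf_neq0 // pnatr_eq0 -lt0n fact_gt0.
have Eab : expR (2 * k)%:R * expR (n - k)%:R = expR (n + k)%:R :> R.
  by rewrite -expRD -natrD abc.
have ft N : 0 < N`!%:R :> R by rewrite ltr0n fact_gt0.
have pt N : (0 < N)%N -> 0 < N%:R ^+ N :> R by move=> h; rewrite exprn_gt0 // ltr0n.
have q0 : 0 <= 1 - (k%:R / n%:R) ^+ 2 :> R.
  rewrite subr_ge0 expr_le1 // ?divr_ge0 //.
  by rewrite ler_pdivrMr // mul1r ltW.
have rhs0 : 0 <= expR 2 / (2 * Num.sqrt pi) * Num.sqrt k%:R * Num.sqrt (1 - (k%:R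
  / n%:R) ^+ 2)
  * (2 * n%:R) ^+ (2 * k) * (n - k)%:R ^+ (n - k) / (n + k)%:R ^+ (n + k) :> R.
  by rewrite divr_ge0 ?mulr_ge0 ?exprn_ge0 ?divr_ge0 ?expR_ge0 ?mulr_ge0 ?sqrtr_ge0.
rewrite -[leRHS]ger0_norm // -sqrtr_sqr; apply: le_trans (ler_norm _) _;
  rewrite -sqrtr_sqr ler_wsqrtr //.
have e4 : expR 2 ^+ 2 = expR 4 :> R by rewrite -expRM_natl; congr expR; ring.
have p0 := pi_gt0 R.
have sk : (2 * k)%:R = 2 * k%:R :> R by rewrite natrM.
have sb : (n - k)%:R = n%:R - k%:R :> R by rewrite natrB.
have sc : (n + k)%:R = n%:R + k%:R :> R by rewrite natrD.
(* This exposes the power $N^N$ with $N = 2k$ that accompanies $(2k)!$. *)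
have -> : (2 * n%:R) ^+ (2 * k) = (n%:R / k%:R) ^+ (2 * k) * (2 * k)%:R ^+ (2 * k) :> R.
  rewrite -exprMn sk; congr (_ ^+ _); by field; rewrite gt_eqF.
have t0 : 0 < (n%:R / k%:R) ^+ (2 * k) :> R by rewrite exprn_gt0 // divr_gt0.
have -> : (expR 2 / (2 * Num.sqrt pi) * Num.sqrt k%:R * Num.sqrt (1 - (k%:R
  / n%:R) ^+ 2)
  * ((n%:R / k%:R) ^+ (2 * k) * (2 * k)%:R ^+ (2 * k)) * (n - k)%:R ^+ (n - k) / (n
    + k)%:R ^+ (n + k)) ^+ 2
  = expR 4 / (4 * pi) * k%:R * (1 - (k%:R / n%:R) ^+ 2)
  * ((n%:R / k%:R) ^+ (2 * k) * (2 * k)%:R ^+ (2 * k) * (n - k)%:R ^+ (n - k) / (n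
    + k)%:R ^+ (n + k)) ^+ 2 :> R.
  have Ep := sqr_sqrtr (ltW p0); have Ex := sqr_sqrtr (ltW x0); have Eq := sqr_sqrtr q0.
  have sp : Num.sqrt pi != 0 :> R by rewrite gt_eqF // sqrtr_gt0.
  rewrite -e4.
  transitivity (expR 2 ^+ 2 / (4 * Num.sqrt pi ^+ 2) * Num.sqrt k%:R ^+ 2 * Num.sqrt (1
    - (k%:R / n%:R) ^+ 2) ^+ 2
  * ((n%:R / k%:R) ^+ (2 * k) * (2 * k)%:R ^+ (2 * k) * (n - k)%:R ^+ (n - k) / (n
    + k)%:R ^+ (n + k)) ^+ 2 : R);
    last by rewrite Ep Ex Eq.
  move: (Num.sqrt pi) sp (Num.sqrt k%:R) (Num.sqrt (1 - _)) => u u0 v z.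
  move: (_ ^+ (2 * k)) (_ ^+ (2 * k)) (_ ^+ (n - k)) (_ ^+ (n + k)) (pt _ c0)
    => A B C D D0.
  by field; rewrite u0 gt_eqF.
rewrite bin invf_div mulrA.
have -> : (2^-1 * (1 + k%:R / n%:R) * (n%:R / k%:R) ^+ (2 * k) * ((n - k)`!%:R * (2
  * k)`!%:R) / (n + k)`!%:R) ^+ 2
  = 4^-1 * (1 + k%:R / n%:R) ^+ 2 * ((n%:R / k%:R) ^+ (2 * k)) ^+ 2 * ((n - k)`!%:R ^+ 2
    * (2 * k)`!%:R ^+ 2) / (n + k)`!%:R ^+ 2 :> R.
  have := ft (n + k)%N; move: (n + k)`!%:R (n - k)`!%:R (2 * k)`!%:R (_ ^+ (2 * k))
    => f g h t f0.
  by field; rewrite !gt_eqF.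
rewrite Fa Fb Fc -Eab.
have sc0 := stirling_gt0 R _ c0.
have ea0 := expR_gt0 ((2 * k)%:R : R); have eb0 := expR_gt0 ((n - k)%:R : R).
move: (pt _ a0) (pt _ b0) (pt _ c0) t0.
move: ((2 * k)%:R ^+ (2 * k)) ((n - k)%:R ^+ (n - k)) ((n + k)%:R ^+ (n + k)) ((n%:R
  / k%:R) ^+ (2 * k)).
rewrite sk sb sc => A B C T A0 B0 C0 T0.
move: S sc0 ea0 eb0; rewrite sk sb.
move: (stirling _ _) (stirling _ _) (stirling _ _) (expR (2 * _)) (expR (_ - _))
  => sa sb' sc' ea eb S sc0 ea0 eb0.
(* This is the common factor by which [S] is multiplied to give the goal. *)
have M0 : 0 <= 2^-1 * k%:R * (1 - (k%:R / n%:R) ^+ 2) * (T * A * B / C) ^+ 2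
  by apply: mulr_ge0; [rewrite !mulr_ge0 // invr_ge0 | exact: sqr_ge0].
have := ler_wpM2l M0 S; move: p0; move: (@pi R) => p p0; congr (_ <= _); last by field;
  rewrite !gt_eqF.
have xy0 : 0 < n%:R + k%:R :> R by lra.
by field; rewrite !gt_eqF.
Qed.

Theorem theorem1p4 (R : realType) (n k : nat)
  (hk : (1 <= k)%N) (hnk : (k + 2 <= n)%N) (w : R)
  (hw : root ((cheb R n)^`(k.+1)) w)
  (hmax : forall x : R, root ((cheb R n)^`(k.+1)) x -> x <= w) :
  (tau n k w) ^+ 2
    <= 2^-1 * (1 + k%:R / n%:R) * (n%:R / k%:R) ^+ (2 * k)
         / ('C(n + k, n - k))%:R
  /\
  2^-1 * (1 + k%:R / n%:R) * (n%:R / k%:R) ^+ (2 * k)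
         / ('C(n + k, n - k))%:R
    <= (expR 2 / (2 * Num.sqrt pi)) * Num.sqrt (k%:R : R)
       * Num.sqrt (1 - (k%:R / n%:R) ^+ 2)
       * (2 * n%:R) ^+ (2 * k) * ((n - k)%:R) ^+ (n - k)
       / ((n + k)%:R) ^+ (n + k).
Proof.
have kn : (k.+1 < n)%N by rewrite addn2 in hnk.
by split; [exact: tau_sqr_le | exact: bin_bound_le].
Qed.
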